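(* Let $\mathcal{C}$ be a fusion category over $\Bbbk$ and let $\mathcal{M}$ be a semisimple indecomposable module category over $\mathcal{C}$. Let $A:=\underline{\mathrm{Hom}}(M,M)$ for a fixed object $M$ of $\mathcal{M}$ such that $\mathcal{M}$ is equivalent to $\mathcal{C}_A$. Then the composition $\mathcal{C}\to\mathcal{C}_A\to\mathcal{M}$ of the functor $-\otimes A:\mathcal{C}\to\mathcal{C}_A$ with the equivalence $\mathcal{C}_A\to\mathcal{M}$ is a separable functor from $\mathcal{C}$ to $\mathcal{M}$.
   Context: $\Bbbk$ is an algebraically closed field. A multitensor category over $\Bbbk$ is a locally finite (finite-dimensional Hom spaces, all objects of finite length) $\Bbbk$-linear abelian rigid monoidal category with bilinear tensor product; a fusion category is a finite (finitely many isomorphism classes of simple objects, enough projectives) semisimple multitensor category with $\mathrm{End}(1)=\Bbbk$. A module category over a monoidal category $\mathcal{C}$ is a category $\mathcal{M}$ with an exact bifunctor $\otimes:\mathcal{C}\times\mathcal{M}\to\mathcal{M}$ and functorial associativity and unit isomorphisms $m_{X,Y,M}:(X\otimes Y)\otimes M\to X\otimes(Y\otimes M)$, $l_M:1\otimes M\to M$ satisfying the usual pentagon and triangle axioms. It is indecomposable if it is not equivalent to a direct sum of two nontrivial module categories. For $M\in\mathcal{M}$ the internal Hom $\underline{\mathrm{Hom}}(M,N)\in\mathcal{C}$ represents the functor $X\mapsto\mathrm{Hom}_{\mathcal{M}}(X\otimes M,N)$; $\underline{\mathrm{Hom}}(M,M)$ is an algebra in $\mathcal{C}$ via composition. By a theorem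 of Ostrik, a semisimple indecomposable module category $\mathcal{M}$ over a fusion category $\mathcal{C}$ is equivalent to $\mathcal{C}_A$ with $A=\underline{\mathrm{Hom}}(M,M)$ for a fixed object $M\in\mathcal{M}$. For an algebra $A$ in $\mathcal{C}$, $\mathcal{C}_A$ is the category of right $A$-modules in $\mathcal{C}$ and $-\otimes A:\mathcal{C}\to\mathcal{C}_A$ is $X\mapsto(X\otimes A,X\otimes m_A)$, $f\mapsto f\otimes A$. A functor $F:\mathcal{C}\to\mathcal{D}$ is separable if there is a natural transformation $\mathcal{P}:\mathrm{Hom}_{\mathcal{D}}(F-,F-)\to\mathrm{Hom}_{\mathcal{C}}(-,-)$ with $\mathcal{P}(F(f))=f$ for every morphism $f$ in $\mathcal{C}$.
   Formalization: The module category M is additionally assumed to be nonzero: the definition of indecomposable given admits M = 0, for which A = 0 and the functor from C to 0 is not separable. *)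

(* Defs.v *)
From HB Require Import structures.
From mathcomp Require Import all_boot all_algebra.

Set Implicit Arguments.
Unset Strict Implicit.
Unset Printing Implicit Defensive.

Import GRing.Theory.
Local Open Scope ring_scope.

Declare Scope cat_scope.
Delimit Scope cat_scope with cat.
Local Open Scope cat_scope.

#[local] Obligation Tactic := (intros; simpl; try by []).

Reserved Notation "g ∘ f" (at level 40, left associativity).
Reserved Notation "X ⊗ Y" (at level 38, left associativity).
Reserved Notation "f ⊗₁ g" (at level 38, left associativity).
Reserved Notation "X ▷ M" (at level 36, right associativity).
Reserved Notation "f ▷₁ g" (at level 36, right associativity).

(* Categories enriched in k-vector spaces; finite-dimensionality of the Hom
   spaces is a separate condition, see [locally_finite]. *)
Record lincat (k : fieldType) := LinCat {
  Ob :> Type;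
  Hom : Ob -> Ob -> lmodType k;
  idm : forall X, Hom X X;
  compm : forall X Y Z, Hom Y Z -> Hom X Y -> Hom X Z;
  compmA : forall X Y Z W (h : Hom Z W) (g : Hom Y Z) (f : Hom X Y),
    compm h (compm g f) = compm (compm h g) f;
  comp1m : forall X Y (f : Hom X Y), compm (idm Y) f = f;
  compm1 : forall X Y (f : Hom X Y), compm f (idm X) = f;
  compm_linearl : forall X Y Z (f : Hom X Y),
    linear (fun g : Hom Y Z => compm g f);
  compm_linearr : forall X Y Z (g : Hom Y Z),
    linear (fun f : Hom X Y => compm g f)
}.

Arguments Hom {k l} X Y.
Arguments idm {k l} X.
Arguments compm {k l X Y Z} g f.

Notation "g ∘ f" := (compm g f) : cat_scope.

Record functor (k : fieldType) (C D : lincat k) := Functor {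
  fob :> C -> D;
  fmor : forall X Y : C, Hom X Y -> Hom (fob X) (fob Y);
  fmor_id : forall X : C, fmor (idm X) = idm (fob X);
  fmor_comp : forall (X Y Z : C) (g : Hom Y Z) (f : Hom X Y),
    fmor (g ∘ f) = fmor g ∘ fmor f
}.

Arguments fmor {k C D} F {X Y} f : rename.

(* Functors out of a product of linear categories, bilinear on morphisms. *)
Record bifunctor (k : fieldType) (C D E : lincat k) := Bifunctor {
  bob :> C -> D -> E;
  bmor : forall (X X' : C) (Y Y' : D),
    Hom X X' -> Hom Y Y' -> Hom (bob X Y) (bob X' Y');
  bmor_id : forall (X : C) (Y : D), bmor (idm X) (idm Y) = idm (bob X Y);
  bmor_comp : forall (X X' X'' : C) (Y Y' Y'' : D)
      (f' : Hom X' X'') (f : Hom X X') (g' : Hom Y' Y'') (g : Hom Y Y'),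
    bmor (f' ∘ f) (g' ∘ g) = bmor f' g' ∘ bmor f g;
  bmor_linearl : forall (X X' : C) (Y Y' : D) (g : Hom Y Y'),
    linear (fun f : Hom X X' => bmor f g);
  bmor_linearr : forall (X X' : C) (Y Y' : D) (f : Hom X X'),
    linear (fun g : Hom Y Y' => bmor f g)
}.

Arguments bmor {k C D E} F {X X' Y Y'} f g : rename.

Section Functors.
Variable k : fieldType.
Implicit Types C D E : lincat k.

Program Definition functor_id C : functor C C :=
  @Functor k C C (fun X => X) (fun X Y f => f) _ _.

Program Definition functor_comp C D E (G : functor D E) (F : functor C D) :
    functor C E :=
  @Functor k C E (fun X => G (F X)) (fun X Y f => fmor G (fmor F f)) _ _.
Next Obligation. by rewrite !fmor_id. Qed.
Next Obligation. by rewrite !fmor_comp. Qed.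

Definition linear_functor C D (F : functor C D) : Prop :=
  forall X Y : C, linear (fun f : Hom X Y => fmor F f).

Definition is_iso C (X Y : C) (f : Hom X Y) : Prop :=
  exists g : Hom Y X, g ∘ f = idm X /\ f ∘ g = idm Y.

Definition isomorphic C (X Y : C) : Prop :=
  exists f : Hom X Y, is_iso f.

Definition naturally_isomorphic C D (F G : functor C D) : Prop :=
  exists t : forall X : C, Hom (F X) (G X),
    (forall X : C, is_iso (t X)) /\
    (forall (X Y : C) (f : Hom X Y), t Y ∘ fmor F f = fmor G f ∘ t X).

Definition is_equivalence C D (F : functor C D) : Prop :=
  exists G : functor D C,
    naturally_isomorphic (functor_comp G F) (functor_id C) /\
    naturally_isomorphic (functor_comp F G) (functor_id D).

(* P is natural in both variables as a transformation
   Hom_D(F -, F -) -> Hom_C(-, -), and is a retraction of f |-> F f. *)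
Definition separable C D (F : functor C D) : Prop :=
  exists P : forall X Y : C, Hom (F X) (F Y) -> Hom X Y,
    (forall (X X' Y Y' : C) (a : Hom X' X) (b : Hom Y Y')
        (g : Hom (F X) (F Y)),
      P X' Y' (fmor F b ∘ g ∘ fmor F a) = b ∘ P X Y g ∘ a) /\
    (forall (X Y : C) (f : Hom X Y), P X Y (fmor F f) = f).

End Functors.

Section Abelian.
Variables (k : fieldType) (C : lincat k).
Implicit Types X Y Z S : C.

Definition is_zero_object X : Prop :=
  (forall Y (f : Hom X Y), f = 0) /\ (forall Y (f : Hom Y X), f = 0).

Definition mono X Y (f : Hom X Y) : Prop :=
  forall Z (g h : Hom Z X), f ∘ g = f ∘ h -> g = h.

Definition epi X Y (f : Hom X Y) : Prop :=
  forall Z (g h : Hom Y Z), g ∘ f = h ∘ f -> g = h.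

Definition is_kernel X Y Z (f : Hom Y Z) (i : Hom X Y) : Prop :=
  f ∘ i = 0 /\
  forall W (g : Hom W Y), f ∘ g = 0 -> exists! h : Hom W X, i ∘ h = g.

Definition is_cokernel X Y Z (f : Hom X Y) (p : Hom Y Z) : Prop :=
  p ∘ f = 0 /\
  forall W (g : Hom Y W), g ∘ f = 0 -> exists! h : Hom Z W, h ∘ p = g.

Definition short_exact X Y Z (i : Hom X Y) (p : Hom Y Z) : Prop :=
  is_kernel p i /\ is_cokernel i p.

(* X is the direct sum (biproduct) of a finite, possibly empty, family. *)
Definition is_direct_sum n (S : 'I_n -> C) X : Prop :=
  exists (inj : forall i, Hom (S i) X) (proj : forall i, Hom X (S i)),
    [/\ forall i, proj i ∘ inj i = idm (S i),
        forall i j, i != j -> proj j ∘ inj i = 0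
      & \sum_(i < n) (inj i ∘ proj i) = idm X].

Definition abelian : Prop :=
  [/\ forall n (S : 'I_n -> C), exists X, is_direct_sum S X,
      forall X Y (f : Hom X Y), exists K (i : Hom K X), is_kernel f i,
      forall X Y (f : Hom X Y), exists Q (p : Hom Y Q), is_cokernel f p,
      forall X Y (f : Hom X Y), mono f -> exists Z (g : Hom Y Z), is_kernel g f
    & forall X Y (f : Hom X Y), epi f -> exists Z (g : Hom Z X), is_cokernel g f].

Definition simple_object X : Prop :=
  ~ is_zero_object X /\
  forall Y (f : Hom Y X), mono f -> is_zero_object Y \/ is_iso f.

Inductive finite_length : C -> Prop :=
| finite_length0 X : is_zero_object X -> finite_length X
| finite_length_ext X Y S (i : Hom X Y) (p : Hom Y S) :
    finite_length X -> short_exact i p -> simple_object S -> finite_length Y.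

Definition hom_finite_dim X Y : Prop :=
  exists n (b : 'I_n -> Hom X Y),
    forall f : Hom X Y, exists c : 'I_n -> k, f = \sum_(i < n) c i *: b i.

Definition locally_finite : Prop :=
  (forall X Y, hom_finite_dim X Y) /\ (forall X, finite_length X).

Definition semisimple : Prop :=
  forall X, exists n (S : 'I_n -> C),
    (forall i, simple_object (S i)) /\ is_direct_sum S X.

Definition finitely_many_simples : Prop :=
  exists n (S : 'I_n -> C), forall X, simple_object X ->
    exists i, isomorphic X (S i).

Definition projective X : Prop :=
  forall Y Z (p : Hom Y Z) (f : Hom X Z), epi p -> exists g, p ∘ g = f.

Definition enough_projectives : Prop :=
  forall X, exists P (p : Hom P X), projective P /\ epi p.

End Abelian.

Record moncat (k : fieldType) := MonCat {
  mon_cat :> lincat k;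
  tens : bifunctor mon_cat mon_cat mon_cat;
  unit_ob : mon_cat;
  asc : forall X Y Z : mon_cat,
    Hom (tens (tens X Y) Z) (tens X (tens Y Z));
  ascV : forall X Y Z : mon_cat,
    Hom (tens X (tens Y Z)) (tens (tens X Y) Z);
  lun : forall X : mon_cat, Hom (tens unit_ob X) X;
  lunV : forall X : mon_cat, Hom X (tens unit_ob X);
  run : forall X : mon_cat, Hom (tens X unit_ob) X;
  runV : forall X : mon_cat, Hom X (tens X unit_ob);
  ascK : forall X Y Z, ascV X Y Z ∘ asc X Y Z = idm _;
  ascVK : forall X Y Z, asc X Y Z ∘ ascV X Y Z = idm _;
  lunK : forall X, lunV X ∘ lun X = idm _;
  lunVK : forall X, lun X ∘ lunV X = idm _;
  runK : forall X, runV X ∘ run X = idm _;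
  runVK : forall X, run X ∘ runV X = idm _;
  asc_natural : forall (X X' Y Y' Z Z' : mon_cat)
      (f : Hom X X') (g : Hom Y Y') (h : Hom Z Z'),
    asc X' Y' Z' ∘ bmor tens (bmor tens f g) h =
    bmor tens f (bmor tens g h) ∘ asc X Y Z;
  lun_natural : forall (X Y : mon_cat) (f : Hom X Y),
    lun Y ∘ bmor tens (idm unit_ob) f = f ∘ lun X;
  run_natural : forall (X Y : mon_cat) (f : Hom X Y),
    run Y ∘ bmor tens f (idm unit_ob) = f ∘ run X;
  mon_pentagon : forall X Y Z W : mon_cat,
    asc X Y (tens Z W) ∘ asc (tens X Y) Z W =
    bmor tens (idm X) (asc Y Z W) ∘ asc X (tens Y Z) W
      ∘ bmor tens (asc X Y Z) (idm W);
  mon_triangle : forall X Y : mon_cat,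
    bmor tens (idm X) (lun Y) ∘ asc X unit_ob Y =
    bmor tens (run X) (idm Y)
}.

Arguments tens {k} m.
Arguments unit_ob {k} m.
Arguments asc {k m} X Y Z.
Arguments ascV {k m} X Y Z.
Arguments lun {k m} X.
Arguments lunV {k m} X.
Arguments run {k m} X.
Arguments runV {k m} X.

Notation "X ⊗ Y" := (bob (tens _) X Y) : cat_scope.
Notation "f ⊗₁ g" := (bmor (tens _) f g) : cat_scope.

Section Fusion.
Variables (k : fieldType) (C : moncat k).

(* X' is a left dual of X, equivalently X is a right dual of X'. *)
Definition is_left_dual (X' X : C) : Prop :=
  exists (ev : Hom (X' ⊗ X) (unit_ob C)) (coev : Hom (unit_ob C) (X ⊗ X')),
    run X ∘ (idm X ⊗₁ ev) ∘ asc X X' X ∘ (coev ⊗₁ idm X) ∘ lunV X = idm X /\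
    lun X' ∘ (ev ⊗₁ idm X') ∘ ascV X' X X' ∘ (idm X' ⊗₁ coev) ∘ runV X'
      = idm X'.

Definition rigid : Prop :=
  forall X : C, (exists X', is_left_dual X' X) /\ (exists X', is_left_dual X X').

Definition multitensor : Prop := [/\ abelian C, locally_finite C & rigid].

(* The last condition is End(1) = k. *)
Definition fusion : Prop :=
  [/\ multitensor, finitely_many_simples C, enough_projectives C, semisimple C
    & bijective (fun c : k => c *: idm (unit_ob C))].

End Fusion.

(* The action bifunctor with its coherent associativity and unit; the
   conditions of abelianness and exactness are in [is_module_category]. *)
Record modcat (k : fieldType) (C : moncat k) := ModCat {
  mc_cat :> lincat k;
  actn : bifunctor C mc_cat mc_cat;
  masc : forall (X Y : C) (M : mc_cat),
    Hom (actn (X ⊗ Y) M) (actn X (actn Y M));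
  mascV : forall (X Y : C) (M : mc_cat),
    Hom (actn X (actn Y M)) (actn (X ⊗ Y) M);
  mlun : forall M : mc_cat, Hom (actn (unit_ob C) M) M;
  mlunV : forall M : mc_cat, Hom M (actn (unit_ob C) M);
  mascK : forall X Y M, mascV X Y M ∘ masc X Y M = idm _;
  mascVK : forall X Y M, masc X Y M ∘ mascV X Y M = idm _;
  mlunK : forall M, mlunV M ∘ mlun M = idm _;
  mlunVK : forall M, mlun M ∘ mlunV M = idm _;
  masc_natural : forall (X X' Y Y' : C) (M M' : mc_cat)
      (f : Hom X X') (g : Hom Y Y') (h : Hom M M'),
    masc X' Y' M' ∘ bmor actn (f ⊗₁ g) h =
    bmor actn f (bmor actn g h) ∘ masc X Y M;
  mlun_natural : forall (M N : mc_cat) (f : Hom M N),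
    mlun N ∘ bmor actn (idm (unit_ob C)) f = f ∘ mlun M;
  mod_pentagon : forall (X Y Z : C) (M : mc_cat),
    masc X Y (actn Z M) ∘ masc (X ⊗ Y) Z M =
    bmor actn (idm X) (masc Y Z M) ∘ masc X (Y ⊗ Z) M
      ∘ bmor actn (asc X Y Z) (idm M);
  mod_triangle : forall (X : C) (M : mc_cat),
    bmor actn (idm X) (mlun M) ∘ masc X (unit_ob C) M =
    bmor actn (run X) (idm M)
}.

Arguments actn {k C} m.
Arguments masc {k C m} X Y M.
Arguments mascV {k C m} X Y M.
Arguments mlun {k C m} M.
Arguments mlunV {k C m} M.

Notation "X ▷ M" := (bob (actn _) X M) : cat_scope.
Notation "f ▷₁ g" := (bmor (actn _) f g) : cat_scope.

Section ModuleCategories.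
Variables (k : fieldType) (C : moncat k).
Implicit Types M N : modcat C.

Definition exact_action M : Prop :=
  (forall (X : C) (M1 M2 M3 : M) (i : Hom M1 M2) (p : Hom M2 M3),
    short_exact i p -> short_exact (idm X ▷₁ i) (idm X ▷₁ p)) /\
  (forall (X1 X2 X3 : C) (M0 : M) (i : Hom X1 X2) (p : Hom X2 X3),
    short_exact i p -> short_exact (i ▷₁ idm M0) (p ▷₁ idm M0)).

Definition is_module_category M : Prop := abelian M /\ exact_action M.

Definition is_module_functor M N (F : functor M N)
    (s : forall (X : C) (M0 : M), Hom (F (X ▷ M0)) (X ▷ F M0)) : Prop :=
  [/\ forall (X : C) (M0 : M), is_iso (s X M0),
      forall (X X' : C) (M1 M2 : M) (f : Hom X X') (g : Hom M1 M2),
        s X' M2 ∘ fmor F (f ▷₁ g) = (f ▷₁ fmor F g) ∘ s X M1,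
      forall (X Y : C) (M0 : M),
        masc X Y (F M0) ∘ s (X ⊗ Y) M0 =
        (idm X ▷₁ s Y M0) ∘ s X (Y ▷ M0) ∘ fmor F (masc X Y M0)
    & forall M0 : M, mlun (F M0) ∘ s (unit_ob C) M0 = fmor F (mlun M0)].

Definition module_equivalence M N (F : functor M N) : Prop :=
  [/\ linear_functor F, is_equivalence F & exists s, is_module_functor (F := F) s].

End ModuleCategories.

(* Direct sum of module categories: pairs of objects, componentwise action. *)
Section DirectSum.
Variables (k : fieldType) (C : moncat k).

Section Category.
Variables C1 C2 : lincat k.

Program Definition prod_cat : lincat k := @LinCat k (C1 * C2)%type
  (fun X Y => (Hom X.1 Y.1 * Hom X.2 Y.2)%type : lmodType k)
  (fun X => (idm X.1, idm X.2))
  (fun X Y Z g f => (g.1 ∘ f.1, g.2 ∘ f.2)) _ _ _ _ _.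
Next Obligation. by rewrite !compmA. Qed.
Next Obligation. by rewrite !comp1m -surjective_pairing. Qed.
Next Obligation. by rewrite !compm1 -surjective_pairing. Qed.
Next Obligation. by move=> ? ? ?; rewrite !compm_linearl. Qed.
Next Obligation. by move=> ? ? ?; rewrite !compm_linearr. Qed.

End Category.

Variables M1 M2 : modcat C.

Program Definition prod_actn : bifunctor C (prod_cat M1 M2) (prod_cat M1 M2) :=
  @Bifunctor k C (prod_cat M1 M2) (prod_cat M1 M2)
    (fun X M => (X ▷ M.1, X ▷ M.2))
    (fun X X' M M' f g => (f ▷₁ g.1, f ▷₁ g.2)) _ _ _ _.
Next Obligation. by rewrite !bmor_id. Qed.
Next Obligation. by rewrite !bmor_comp. Qed.
Next Obligation. by move=> ? ? ?; rewrite !bmor_linearl. Qed.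
Next Obligation. by move=> ? ? ?; rewrite !bmor_linearr. Qed.

Program Definition modcat_sum : modcat C := @ModCat k C (prod_cat M1 M2)
  prod_actn
  (fun X Y M => (masc X Y M.1, masc X Y M.2))
  (fun X Y M => (mascV X Y M.1, mascV X Y M.2))
  (fun M => (mlun M.1, mlun M.2))
  (fun M => (mlunV M.1, mlunV M.2)) _ _ _ _ _ _ _ _.
Next Obligation. by rewrite !mascK. Qed.
Next Obligation. by rewrite !mascVK. Qed.
Next Obligation. by rewrite !mlunK. Qed.
Next Obligation. by rewrite !mlunVK. Qed.
Next Obligation. by rewrite !masc_natural. Qed.
Next Obligation. by rewrite !mlun_natural. Qed.
Next Obligation. by rewrite !mod_pentagon. Qed.
Next Obligation. by rewrite !mod_triangle. Qed.

End DirectSum.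

Section Indecomposable.
Variables (k : fieldType) (C : moncat k).

Definition nontrivial (M : lincat k) : Prop :=
  exists M0 : M, ~ is_zero_object M0.

(* As stated, the zero module category is indecomposable. *)
Definition indecomposable (M : modcat C) : Prop :=
  ~ exists M1 M2 : modcat C,
      [/\ is_module_category M1, is_module_category M2,
          nontrivial M1, nontrivial M2
        & exists F : functor M (modcat_sum M1 M2), module_equivalence F].

End Indecomposable.

Section Coherence.
Variables (k : fieldType) (C : moncat k) (M : modcat C).

Lemma bmorE (C1 C2 C3 : lincat k) (F : bifunctor C1 C2 C3) (X X' : C1)
    (Y Y' : C2) (f : Hom X X') (g : Hom Y Y') :
  bmor F f g = bmor F f (idm _) ∘ bmor F (idm _) g.
Proof. by rewrite -bmor_comp comp1m compm1. Qed.

Lemma bmorE' (C1 C2 C3 : lincat k) (F : bifunctor C1 C2 C3) (X X' : C1)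
    (Y Y' : C2) (f : Hom X X') (g : Hom Y Y') :
  bmor F f g = bmor F (idm _) g ∘ bmor F f (idm _).
Proof. by rewrite -bmor_comp comp1m compm1. Qed.

Lemma bmor_compl (C1 C2 C3 : lincat k) (F : bifunctor C1 C2 C3) (X X' X'' : C1)
    (Y : C2) (f : Hom X' X'') (g : Hom X X') :
  bmor F (f ∘ g) (idm Y) = bmor F f (idm Y) ∘ bmor F g (idm Y).
Proof. by rewrite -bmor_comp comp1m. Qed.

Lemma bmor_compr (C1 C2 C3 : lincat k) (F : bifunctor C1 C2 C3) (X : C1)
    (Y Y' Y'' : C2) (f : Hom Y' Y'') (g : Hom Y Y') :
  bmor F (idm X) (f ∘ g) = bmor F (idm X) f ∘ bmor F (idm X) g.
Proof. by rewrite -bmor_comp comp1m. Qed.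

Lemma comp_caniso_r (D : lincat k) (X Y Z : D) (i : Hom X Y) (j : Hom Y X)
    (f g : Hom Y Z) : i ∘ j = idm Y -> f ∘ i = g ∘ i -> f = g.
Proof. by move=> ij e; rewrite -[f]compm1 -[g]compm1 -ij !compmA e. Qed.

Lemma comp_caniso_l (D : lincat k) (X Y Z : D) (i : Hom X Y) (j : Hom Y X)
    (f g : Hom Z X) : j ∘ i = idm X -> i ∘ f = i ∘ g -> f = g.
Proof. by move=> ji e; rewrite -[f]comp1m -[g]comp1m -ji -!compmA e. Qed.

Lemma mlun_act (X : C) (N : M) :
  mlun (X ▷ N) ∘ masc (unit_ob C) X N = lun X ▷₁ idm N.
Proof.
have faith (N1 N2 : M) (f g : Hom N1 N2) :
    idm (unit_ob C) ▷₁ f = idm (unit_ob C) ▷₁ g -> f = g.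
  move=> e; apply: (comp_caniso_r (i := mlun N1) (j := mlunV N1)).
    exact: mlunVK.
  by rewrite -!mlun_natural e.
apply: faith.
apply: (comp_caniso_r (mascVK _ _ _)).
apply: (comp_caniso_r (i := asc _ _ _ ▷₁ idm N) (j := ascV _ _ _ ▷₁ idm N)).
  by rewrite -bmor_compl ascVK bmor_id.
rewrite bmor_compr -!compmA [_ ∘ (masc _ _ _ ∘ _)]compmA.
rewrite -mod_pentagon !compmA mod_triangle -[idm (X ▷ N)]bmor_id.
by rewrite -!masc_natural -compmA -bmor_compl mon_triangle.
Qed.

Lemma run_tens (X Y : C) :
  (idm X ⊗₁ run Y) ∘ asc X Y (unit_ob C) = run (X ⊗ Y).
Proof.
have faith (X1 X2 : C) (f g : Hom X1 X2) :
    f ⊗₁ idm (unit_ob C) = g ⊗₁ idm (unit_ob C) -> f = g.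
  move=> e; apply: (comp_caniso_r (i := run X1) (j := runV X1)).
    exact: runVK.
  by rewrite -!run_natural e.
apply: faith.
apply: (comp_caniso_l (ascK _ _ _)).
rewrite -mon_triangle bmor_compl !compmA asc_natural -mon_triangle.
rewrite -[idm (X ⊗ Y)]bmor_id asc_natural -[RHS]compmA mon_pentagon.
by rewrite bmor_compr !compmA.
Qed.

End Coherence.

Section Regular.
Variables (k : fieldType) (C : moncat k).

Definition regular_modcat : modcat C :=
  @ModCat k C C (tens C) asc ascV lun lunV
    (@ascK k C) (@ascVK k C) (@lunK k C) (@lunVK k C)
    (@asc_natural k C) (@lun_natural k C) (@mon_pentagon k C) (@mon_triangle k C).

Lemma lun_tens (X Y : C) : lun (X ⊗ Y) ∘ asc (unit_ob C) X Y = lun X ⊗₁ idm Y.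
Proof. exact: (@mlun_act k C regular_modcat). Qed.

End Regular.

Record algebra (k : fieldType) (C : moncat k) := Algebra {
  alg_ob :> C;
  alg_mul : Hom (alg_ob ⊗ alg_ob) alg_ob;
  alg_unit : Hom (unit_ob C) alg_ob;
  alg_mulA : alg_mul ∘ (alg_mul ⊗₁ idm alg_ob) =
    alg_mul ∘ (idm alg_ob ⊗₁ alg_mul) ∘ asc alg_ob alg_ob alg_ob;
  alg_mul1l : alg_mul ∘ (alg_unit ⊗₁ idm alg_ob) = lun alg_ob;
  alg_mul1r : alg_mul ∘ (idm alg_ob ⊗₁ alg_unit) = run alg_ob
}.

Arguments alg_mul {k C} a.
Arguments alg_unit {k C} a.

Record rmodule (k : fieldType) (C : moncat k) (A : algebra C) := RModule {
  rm_ob :> C;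
  rm_act : Hom (rm_ob ⊗ A) rm_ob;
  rm_actA : rm_act ∘ (rm_act ⊗₁ idm A) =
    rm_act ∘ (idm rm_ob ⊗₁ alg_mul A) ∘ asc rm_ob A A;
  rm_act1 : rm_act ∘ (idm rm_ob ⊗₁ alg_unit A) = run rm_ob
}.

Arguments rm_act {k C A} r.

Section ModuleHom.
Variables (k : fieldType) (C : moncat k) (A : algebra C).

Definition is_rmod_hom (X Y : rmodule A) (f : Hom (rm_ob X) (rm_ob Y)) : bool :=
  f ∘ rm_act X == rm_act Y ∘ (f ⊗₁ idm A).

Lemma is_rmod_hom_closed (X Y : rmodule A) :
  subsemimod_closed (@is_rmod_hom X Y).
Proof.
apply: GRing.submod_closed_semi; split.
  rewrite unfold_in /is_rmod_hom.
  have l0 (V W : lmodType k) (h : V -> W) : linear h -> h 0 = 0.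
    by move=> /(_ (-1) 0 0); rewrite scaler0 addr0 scaleN1r addNr.
  rewrite (l0 _ _ _ (@compm_linearl _ _ _ _ _ (rm_act X))).
  rewrite (l0 _ _ _ (@bmor_linearl _ _ _ _ (tens C) _ _ _ _ (idm (A : C)))).
  by rewrite (l0 _ _ _ (@compm_linearr _ _ _ _ _ (rm_act Y))).
move=> a f g; rewrite !unfold_in /is_rmod_hom => /eqP ef /eqP eg.
by rewrite compm_linearl bmor_linearl compm_linearr ef eg.
Qed.

HB.instance Definition _ (X Y : rmodule A) :=
  GRing.isSubmodClosed.Build k _ (@is_rmod_hom X Y) (@is_rmod_hom_closed X Y).

Record rmod_hom (X Y : rmodule A) := RModHom {
  rmod_hom_val : Hom (rm_ob X) (rm_ob Y);
  rmod_homP : @is_rmod_hom X Y rmod_hom_val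
}.

HB.instance Definition _ X Y := [isSub for @rmod_hom_val X Y].
HB.instance Definition _ X Y := [Choice of rmod_hom X Y by <:].
HB.instance Definition _ X Y := [SubChoice_isSubLmodule of rmod_hom X Y by <:].

End ModuleHom.

Section RModCat.
Variables (k : fieldType) (C : moncat k) (A : algebra C).
Implicit Types X Y Z : rmodule A.

Lemma rmod_hom_id_subproof X : @is_rmod_hom _ _ _ X X (idm _).
Proof. by rewrite /is_rmod_hom bmor_id comp1m compm1. Qed.

Lemma rmod_hom_comp_subproof X Y Z (g : rmod_hom Y Z) (f : rmod_hom X Y) :
  @is_rmod_hom _ _ _ X Z (val g ∘ val f).
Proof.
case: g f => g /eqP eg [f /eqP ef] /=; apply/eqP.
by rewrite bmor_compl compmA -eg -!compmA ef.
Qed.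

Definition rmod_id X : rmod_hom X X := RModHom (rmod_hom_id_subproof X).
Definition rmod_comp X Y Z (g : rmod_hom Y Z) (f : rmod_hom X Y) : rmod_hom X Z :=
  RModHom (rmod_hom_comp_subproof g f).

Program Definition rmod_cat : lincat k := @LinCat k (rmodule A)
  (fun X Y => rmod_hom X Y : lmodType k) rmod_id rmod_comp _ _ _ _ _.
Next Obligation. by apply: val_inj; rewrite /= compmA. Qed.
Next Obligation. by apply: val_inj; rewrite /= comp1m. Qed.
Next Obligation. by apply: val_inj; rewrite /= compm1. Qed.
Next Obligation. by move=> ? ? ?; apply: val_inj; rewrite /= compm_linearl. Qed.
Next Obligation. by move=> ? ? ?; apply: val_inj; rewrite /= compm_linearr. Qed.

Program Definition rmod_tens (X : C) (Y : rmodule A) : rmodule A :=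
  @RModule k C A (X ⊗ rm_ob Y) ((idm X ⊗₁ rm_act Y) ∘ asc X Y A) _ _.
Next Obligation.
rewrite bmor_compl !compmA -[_ ∘ asc _ _ _ ∘ (_ ⊗₁ idm A)]compmA.
rewrite asc_natural !compmA -bmor_compr rm_actA.
rewrite !bmor_compr -!compmA; congr (_ ∘ _).
rewrite -[idm (X ⊗ Y)]bmor_id [_ ∘ (_ ∘ asc (X ⊗ Y) A A)]compmA asc_natural.
by rewrite -[RHS]compmA mon_pentagon !compmA.
Qed.
Next Obligation.
by rewrite -compmA -bmor_id asc_natural compmA -bmor_compr rm_act1 run_tens.
Qed.

Lemma rmod_tens_hom_subproof (X X' : C) Y Y' (f : Hom X X') (g : rmod_hom Y Y') :
  @is_rmod_hom _ _ _ (rmod_tens X Y) (rmod_tens X' Y') (f ⊗₁ val g).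
Proof.
case: g => g /eqP eg /=; apply/eqP => /=.
rewrite compmA -bmor_comp compm1 eg -compmA asc_natural compmA -bmor_comp.
by rewrite comp1m.
Qed.

Program Definition rmod_actn : bifunctor C rmod_cat rmod_cat :=
  @Bifunctor k C rmod_cat rmod_cat rmod_tens
    (fun (X X' : C) (Y Y' : rmodule A) f g => RModHom (rmod_tens_hom_subproof f g)) _ _ _ _.
Next Obligation. by apply: val_inj; rewrite /= bmor_id. Qed.
Next Obligation. by apply: val_inj; rewrite /= bmor_comp. Qed.
Next Obligation. by move=> ? ? ?; apply: val_inj; rewrite /= bmor_linearl. Qed.
Next Obligation. by move=> ? ? ?; apply: val_inj; rewrite /= bmor_linearr. Qed.

Lemma rmod_asc_subproof (X Y : C) (Z : rmodule A) :
  @is_rmod_hom _ _ _ (rmod_tens (X ⊗ Y) Z) (rmod_tens X (rmod_tens Y Z))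
    (asc X Y Z).
Proof.
apply/eqP => /=; rewrite -[idm (X ⊗ Y)]bmor_id compmA asc_natural -compmA.
by rewrite mon_pentagon bmor_compr !compmA.
Qed.

Lemma is_rmod_homV X Y (f : Hom (rm_ob X) (rm_ob Y)) (g : Hom (rm_ob Y) (rm_ob X)) :
  g ∘ f = idm _ -> f ∘ g = idm _ -> is_rmod_hom f -> is_rmod_hom g.
Proof.
move=> gf fg /eqP ef; apply/eqP; apply: (comp_caniso_l gf).
by rewrite !compmA fg comp1m ef -compmA -bmor_compl fg bmor_id compm1.
Qed.

Lemma rmod_ascV_subproof (X Y : C) (Z : rmodule A) :
  @is_rmod_hom _ _ _ (rmod_tens X (rmod_tens Y Z)) (rmod_tens (X ⊗ Y) Z)
    (ascV X Y Z).
Proof.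
exact: (@is_rmod_homV (rmod_tens (X ⊗ Y) Z) (rmod_tens X (rmod_tens Y Z))
  (asc X Y Z) (ascV X Y Z) (ascK _ _ _) (ascVK _ _ _) (rmod_asc_subproof _ _ _)).
Qed.

Lemma rmod_lun_subproof X :
  @is_rmod_hom _ _ _ (rmod_tens (unit_ob C) X) X (lun X).
Proof.
by apply/eqP => /=; rewrite compmA lun_natural -compmA lun_tens.
Qed.

Lemma rmod_lunV_subproof X :
  @is_rmod_hom _ _ _ X (rmod_tens (unit_ob C) X) (lunV X).
Proof.
exact: (@is_rmod_homV (rmod_tens (unit_ob C) X) X (lun X) (lunV X)
  (lunK _) (lunVK _) (rmod_lun_subproof _)).
Qed.

Program Definition rmod_modcat : modcat C := @ModCat k C rmod_cat rmod_actn
  (fun (X Y : C) (M : rmodule A) => RModHom (rmod_asc_subproof X Y M))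
  (fun (X Y : C) (M : rmodule A) => RModHom (rmod_ascV_subproof X Y M))
  (fun M : rmodule A => RModHom (rmod_lun_subproof M))
  (fun M : rmodule A => RModHom (rmod_lunV_subproof M)) _ _ _ _ _ _ _ _.
Next Obligation. by apply: val_inj; rewrite /= ascK. Qed.
Next Obligation. by apply: val_inj; rewrite /= ascVK. Qed.
Next Obligation. by apply: val_inj; rewrite /= lunK. Qed.
Next Obligation. by apply: val_inj; rewrite /= lunVK. Qed.
Next Obligation. by apply: val_inj; rewrite /= asc_natural. Qed.
Next Obligation. by apply: val_inj; rewrite /= lun_natural. Qed.
Next Obligation. by apply: val_inj; rewrite /= mon_pentagon. Qed.
Next Obligation. by apply: val_inj; rewrite /= mon_triangle. Qed.

Program Definition free_rmod (X : C) : rmodule A :=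
  @RModule k C A (X ⊗ A) ((idm X ⊗₁ alg_mul A) ∘ asc X A A) _ _.
Next Obligation.
rewrite bmor_compl !compmA -[_ ∘ asc _ _ _ ∘ (_ ⊗₁ idm A)]compmA.
rewrite asc_natural !compmA -bmor_compr alg_mulA.
rewrite !bmor_compr -!compmA; congr (_ ∘ _).
rewrite -[idm (X ⊗ A)]bmor_id [_ ∘ (_ ∘ asc (X ⊗ A) A A)]compmA asc_natural.
by rewrite -[RHS]compmA mon_pentagon !compmA.
Qed.
Next Obligation.
by rewrite -compmA -bmor_id asc_natural compmA -bmor_compr alg_mul1r run_tens.
Qed.

Lemma free_rmod_hom_subproof (X Y : C) (f : Hom X Y) :
  @is_rmod_hom _ _ _ (free_rmod X) (free_rmod Y) (f ⊗₁ idm A).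
Proof.
apply/eqP => /=.
rewrite compmA -bmor_comp compm1 comp1m -compmA asc_natural compmA -bmor_comp.
by rewrite bmor_id comp1m compm1.
Qed.

Program Definition free_functor : functor C rmod_cat :=
  @Functor k C rmod_cat free_rmod
    (fun (X Y : C) f => RModHom (free_rmod_hom_subproof f)) _ _.
Next Obligation. by apply: val_inj; rewrite /= bmor_id. Qed.
Next Obligation. by apply: val_inj; rewrite /= bmor_compl. Qed.

End RModCat.

(* An object of C representing X |-> Hom_M(X ▷ M1, M2). *)
Record internal_hom (k : fieldType) (C : moncat k) (M : modcat C) (M1 M2 : M) :=
InternalHom {
  ih_ob :> C;
  ih_rep : forall X : C, Hom (X ▷ M1) M2 -> Hom X ih_ob;
  ih_repV : forall X : C, Hom X ih_ob -> Hom (X ▷ M1) M2;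
  ih_repK : forall X, cancel (@ih_rep X) (@ih_repV X);
  ih_repVK : forall X, cancel (@ih_repV X) (@ih_rep X);
  ih_natural : forall (X Y : C) (f : Hom X Y) (g : Hom (Y ▷ M1) M2),
    ih_rep (g ∘ (f ▷₁ idm M1)) = ih_rep g ∘ f
}.

Section InternalEnd.
Variables (k : fieldType) (C : moncat k) (M : modcat C).

Definition ih_ev (M1 M2 : M) (H : internal_hom M1 M2) : Hom (H ▷ M1) M2 :=
  ih_repV (idm (H : C)).

Lemma ih_ev_rep (M1 M2 : M) (H : internal_hom M1 M2) (X : C)
  (g : Hom (X ▷ M1) M2) : ih_ev H ∘ (ih_rep H g ▷₁ idm M1) = g.
Proof.
apply: (can_inj (@ih_repK _ _ _ _ _ H X)).
by rewrite ih_natural /ih_ev ih_repVK comp1m.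
Qed.

Lemma ih_ev_inj (M1 M2 : M) (H : internal_hom M1 M2) (X : C) (f g : Hom X H) :
  ih_ev H ∘ (f ▷₁ idm M1) = ih_ev H ∘ (g ▷₁ idm M1) -> f = g.
Proof.
move=> /(congr1 (@ih_rep _ _ _ _ _ H X)).
by rewrite !ih_natural /ih_ev ih_repVK !comp1m.
Qed.

Variables (M0 : M) (A : internal_hom M0 M0).

(* The composition of internal Homs: the map A ⊗ A -> A adjoint to
   (A ⊗ A) ▷ M0 -> A ▷ (A ▷ M0) -> A ▷ M0 -> M0. *)
Definition iend_mul : Hom (ih_ob A ⊗ ih_ob A) A :=
  ih_rep A (ih_ev A ∘ (idm (A : C) ▷₁ ih_ev A) ∘ masc A A M0).

Definition iend_unit : Hom (unit_ob C) A := ih_rep A (mlun M0).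

Program Definition iend_algebra : algebra C :=
  @Algebra k C A iend_mul iend_unit _ _ _.
Next Obligation.
apply: ih_ev_inj; rewrite !bmor_compl !compmA !ih_ev_rep.
rewrite -[LHS]compmA masc_natural bmor_id.
rewrite -[_ ∘ masc A A M0 ∘ _]compmA masc_natural.
rewrite !compmA -[_ ∘ (idm (A : C) ▷₁ ih_ev A) ∘ (idm (A : C) ▷₁ (iend_mul ▷₁ _))]compmA.
rewrite -bmor_compr ih_ev_rep.
rewrite -[_ ∘ _ ∘ (iend_mul ▷₁ _)]compmA -bmorE'  bmorE !compmA ih_ev_rep.
rewrite -[_ ∘ masc A A M0 ∘ _]compmA -[idm ((A : C) ⊗ _)]bmor_id masc_natural.
rewrite !bmor_compr !compmA -[LHS]compmA mod_pentagon.
by rewrite !compmA.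
Qed.
Next Obligation.
apply: ih_ev_inj; rewrite bmor_compl !compmA ih_ev_rep.
rewrite -[LHS]compmA masc_natural bmor_id !compmA.
rewrite -[_ ∘ _ ∘ (iend_unit ▷₁ _)]compmA -bmorE' bmorE !compmA ih_ev_rep.
by rewrite mlun_natural -compmA mlun_act.
Qed.
Next Obligation.
apply: ih_ev_inj; rewrite bmor_compl !compmA ih_ev_rep.
rewrite -[LHS]compmA masc_natural !compmA.
by rewrite -[_ ∘ _ ∘ (idm _ ▷₁ _)]compmA -bmor_compr ih_ev_rep -[LHS]compmA mod_triangle.
Qed.

End InternalEnd.

(* Main.v *)
From mathcomp Require Import all_boot all_algebra.
Require Import Defs.

(** Both functors in the composite [C -> C_A -> M] are separable, and separable
    functors compose.  An equivalence [E] with quasi-inverse [G] is separable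
    because conjugating [G g] by the natural isomorphism [G E -> id] undoes
    [E].  For the free functor, everything comes down to the unit [u : 1 -> A]:
    a retraction [r] of [u] turns an arrow [g : X ⊗ A -> Y ⊗ A] into
    [X -> X ⊗ A -> Y ⊗ A -> Y], inserting [u] before [g] and applying [r]
    after it ([free_functor_separable]).

    Such an [r] exists as soon as [u <> 0].  Since [End(1) = k], every simple
    summand of [1] is all of [1]; by Schur's lemma a nonzero arrow from a simple
    object to the semisimple object [A] is invertible onto some summand of [A],
    hence split ([simple_split_mono], [unit_split_mono]).  Finally [u] cannot
    vanish: the unit axiom of right modules would then kill every object of
    [C_A], whereas [C_A] is equivalent to [M], which is not trivial
    ([alg_unit_neq0]). *)

Set Implicit Arguments.
Unset Strict Implicit.
Unset Printing Implicit Defensive.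

Import GRing.Theory.
Local Open Scope ring_scope.
Local Open Scope cat_scope.

Lemma linear_fun0 (k : fieldType) (V W : lmodType k) (h : V -> W) :
  linear h -> h 0 = 0.
Proof. by move=> /(_ (-1) 0 0); rewrite scaler0 addr0 scaleN1r addNr. Qed.

Section LinearCategories.
Variables (k : fieldType) (C : lincat k).

Lemma comp0m (X Y Z : C) (f : Hom X Y) : (0 : Hom Y Z) ∘ f = 0.
Proof. exact: (linear_fun0 (compm_linearl f)). Qed.

Lemma compm0 (X Y Z : C) (g : Hom Y Z) : g ∘ (0 : Hom X Y) = 0.
Proof. exact: (linear_fun0 (compm_linearr g)). Qed.

Lemma compZm (X Y Z : C) (c : k) (g : Hom Y Z) (f : Hom X Y) :
  (c *: g) ∘ f = c *: (g ∘ f).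
Proof. by rewrite -[c *: g]addr0 (compm_linearl f) comp0m addr0. Qed.

Lemma compmB (X Y Z : C) (g : Hom Y Z) (f h : Hom X Y) :
  g ∘ (f - h) = g ∘ f - g ∘ h.
Proof. by rewrite -[f - h]addrC -scaleN1r (compm_linearr g) scaleN1r addrC. Qed.

Lemma comp_suml (X Y Z : C) n (g : 'I_n -> Hom Y Z) (f : Hom X Y) :
  (\sum_(i < n) g i) ∘ f = \sum_(i < n) (g i ∘ f).
Proof.
apply: (big_morph (fun g : Hom Y Z => g ∘ f)); last exact: comp0m.
by move=> g1 g2; rewrite -[g1]scale1r (compm_linearl f) !scale1r.
Qed.

Lemma is_zero_objectP (X : C) : idm X = 0 -> is_zero_object X.
Proof.
by move=> id0; split=> Y f; [rewrite -[f]compm1 | rewrite -[f]comp1m];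
  rewrite id0 (compm0, comp0m).
Qed.

Lemma mono_kernel0 (X Y K : C) (f : Hom X Y) (i : Hom K X) :
  is_kernel f i -> is_zero_object K -> mono f.
Proof.
move=> [_ ker_i] [K0 _] Z g h fgh; apply/eqP; rewrite -subr_eq0.
have [|j [<- _]] := ker_i _ (g - h); first by rewrite compmB fgh subrr.
by rewrite (K0 _ i) comp0m.
Qed.

Lemma kernel_mono (X Y K : C) (f : Hom X Y) (i : Hom K X) :
  is_kernel f i -> mono i.
Proof.
move=> [fi0 ker_i] Z g h igh.
have [|j [_ uniq_j]] := ker_i _ (i ∘ h); first by rewrite compmA fi0 comp0m.
by rewrite -(uniq_j g igh); apply: uniq_j.
Qed.

(** Schur's lemma: the kernel of a nonzero [f] is a proper subobject of [S],
    hence zero, so [f] exhibits [S] as a nonzero subobject of [T], which must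
    be all of [T]. *)
Lemma schur (S T : C) (f : Hom S T) :
  abelian C -> simple_object S -> simple_object T -> f <> 0 -> is_iso f.
Proof.
move=> [_ kerC _ _ _] [S_nz S_simple] [_ T_simple] f_nz.
have [K [i ker_i]] := kerC _ _ f.
have f_mono : mono f.
  apply: (mono_kernel0 ker_i).
  have [//|[j [_ ij]]] := S_simple _ _ (kernel_mono ker_i).
  by case: f_nz; rewrite -[f]compm1 -ij compmA (proj1 ker_i) comp0m.
by have [|] := T_simple _ _ f_mono.
Qed.

(** Some component of [f] along the simple summands of [Y] is nonzero, hence
    invertible by Schur's lemma. *)
Lemma simple_split_mono (S Y : C) (f : Hom S Y) :
  abelian C -> semisimple C -> simple_object S -> f <> 0 ->
  exists r : Hom Y S, r ∘ f = idm S.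
Proof.
move=> C_ab C_ss S_simple f_nz.
have [n [T [T_simple [inj [proj [_ _ sum_ip]]]]]] := C_ss Y.
have [/forallP all0|] := boolP [forall i, proj i ∘ f == 0].
  case: f_nz; rewrite -[f]comp1m -sum_ip comp_suml big1 // => i _.
  by rewrite -compmA (eqP (all0 i)) compm0.
rewrite negb_forall => /existsP[i /eqP pf_nz].
have [g [gpf _]] := schur C_ab S_simple (T_simple i) pf_nz.
by exists (g ∘ proj i); rewrite -compmA.
Qed.

(** The projector onto a simple summand of [X] is a scalar, and that scalar is
    an invertible idempotent because the summand is nonzero; so [X] is its own
    simple summand. *)
Lemma scalar_end_simple (X : C) :
  semisimple C -> bijective (fun c : k => c *: idm X) ->
  exists (S : C) (i : Hom S X) (p : Hom X S),
    [/\ simple_object S, p ∘ i = idm S & i ∘ p = idm X].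
Proof.
move=> C_ss [coef coefK coefVK].
have X_nz : idm X <> 0.
  move=> id0; apply: (elimN eqP (oner_neq0 k)).
  by rewrite -(coefK 1) -[RHS]coefK id0 !scaler0.
have [[|n] [S [S_simple [inj [proj [projK _ sum_ip]]]]]] := C_ss X.
  by case: X_nz; rewrite -sum_ip big_ord0.
exists (S ord0), (inj ord0), (proj ord0); split=> //.
have [c ip] : exists c, inj ord0 ∘ proj ord0 = c *: idm X.
  by exists (coef (inj ord0 ∘ proj ord0)); rewrite coefVK.
have inj_nz : inj ord0 <> 0.
  move=> inj0; case: (S_simple ord0) => S_nz _; apply: S_nz.
  by apply: is_zero_objectP; rewrite -projK inj0 compm0.
(* Composing with the inclusion gives [c *: inj = inj], so [c = 1]. *)
have /eqP : (c - 1) *: inj ord0 = 0.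
  rewrite scalerBl scale1r -[in c *: _](comp1m (inj ord0)) -compZm -ip.
  by rewrite -compmA projK compm1 subrr.
rewrite scaler_eq0 => /orP[|/eqP//].
by rewrite subr_eq0 ip => /eqP ->; rewrite scale1r.
Qed.

End LinearCategories.

Section Separability.
Variable k : fieldType.

Lemma separable_comp (C D E : lincat k) (G : functor D E) (F : functor C D) :
  separable G -> separable F -> separable (functor_comp G F).
Proof.
move=> [Q [Q_nat QK]] [P [P_nat PK]].
exists (fun X Y g => P X Y (Q (F X) (F Y) g)); split=> [X X' Y Y' a b g|X Y f].
  by rewrite /= Q_nat P_nat.
by rewrite /= QK PK.
Qed.

(** Hom spaces carry a choice operator, so that an inverse of each component
    of a natural isomorphism can be selected without the axiom of choice. *)
Lemma iso_family_inverse (I : Type) (C : lincat k) (X Y : I -> C)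
    (t : forall i, Hom (X i) (Y i)) :
  (forall i, is_iso (t i)) ->
  exists tV : forall i, Hom (Y i) (X i),
    forall i, tV i ∘ t i = idm (X i) /\ t i ∘ tV i = idm (Y i).
Proof.
move=> t_iso.
have ex i : exists g : Hom (Y i) (X i),
    (g ∘ t i == idm (X i)) && (t i ∘ g == idm (Y i)).
  by have [g [gt tg]] := t_iso i; exists g; rewrite gt tg !eqxx.
exists (fun i => xchoose (ex i)) => i.
by have /andP[/eqP ? /eqP ?] := xchooseP (ex i).
Qed.

(** The retraction [g |-> t ∘ G g ∘ t^-1] comes from the isomorphism
    [t : G F -> id], whose naturality turns [G (F f)] back into [f]. *)
Lemma equivalence_separable (C D : lincat k) (F : functor C D) :
  is_equivalence F -> separable F.
Proof.
move=> [G [[t [t_iso t_nat]] _]].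
have [tV tVK] := iso_family_inverse t_iso.
have tV_nat X Y (f : Hom X Y) : fmor G (fmor F f) ∘ tV X = tV Y ∘ f.
  apply: (comp_caniso_l (proj1 (tVK Y))).
  rewrite !compmA (proj2 (tVK Y)) comp1m (t_nat X Y f) -compmA.
  by rewrite (proj2 (tVK X)) compm1.
exists (fun X Y g => t Y ∘ fmor G g ∘ tV X); split=> [X X' Y Y' a b g|X Y f].
  rewrite !fmor_comp !compmA (t_nat Y Y' b) -!compmA.
  by rewrite tV_nat.
by rewrite -compmA tV_nat compmA (proj2 (tVK Y)) comp1m.
Qed.

(** Linearity makes [F] send zero objects to zero objects, as
    [F] then maps [id = 0] to [id = 0]; so a preimage of a nonzero object is
    nonzero. *)
Lemma equivalence_nontrivial (C D : lincat k) (F : functor C D) :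
  linear_functor F -> is_equivalence F -> nontrivial D -> nontrivial C.
Proof.
move=> F_lin [G [_ [t [t_iso _]]]] [Y Y_nz].
exists (G Y) => -[GY0 _]; apply: Y_nz; apply: is_zero_objectP.
have [tV [_ ttV]] := t_iso Y.
have id0 : fmor F (idm (G Y)) = 0.
  by rewrite (GY0 _ (idm _)) (linear_fun0 (F_lin _ _)).
by rewrite -ttV -[t Y]compm1 /= -fmor_id id0 compm0 comp0m.
Qed.

End Separability.

Section FreeModules.
Variables (k : fieldType) (C : moncat k) (A : algebra C).

Lemma runV_natural (X Y : C) (f : Hom X Y) :
  runV Y ∘ f = (f ⊗₁ idm (unit_ob C)) ∘ runV X.
Proof.
apply: (comp_caniso_l (runK Y)).
by rewrite !compmA runVK comp1m run_natural -compmA runVK compm1.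
Qed.

(** With [u = alg_unit A], the map [g |-> run ∘ (id ⊗ r) ∘ g ∘ (id ⊗ u) ∘ runV]
    is natural because [run] and [runV] are,
    and on [g = f ⊗ id] the arrows [u] and [r] cancel by the interchange law, leaving [f]. *)
Lemma free_functor_separable (r : Hom (A : C) (unit_ob C)) :
  r ∘ alg_unit A = idm (unit_ob C) -> separable (free_functor A).
Proof.
move=> ru.
exists (fun X Y (g : rmod_hom (free_rmod A X) (free_rmod A Y)) =>
  run Y ∘ (idm Y ⊗₁ r) ∘ val g ∘ (idm X ⊗₁ alg_unit A) ∘ runV X).
split=> [X X' Y Y' a b g|X Y f] /=.
  rewrite !compmA -[_ ∘ (_ ⊗₁ r) ∘ (b ⊗₁ _)]compmA -bmorE' [b ⊗₁ r]bmorE.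
  rewrite !compmA run_natural -!compmA; do 4 congr (_ ∘ _).
  by rewrite runV_natural !compmA -bmorE -bmorE'.
rewrite -!compmA [(f ⊗₁ _) ∘ _]compmA -bmorE.
rewrite [(_ ⊗₁ r) ∘ _]compmA -bmor_comp comp1m ru compmA run_natural.
by rewrite -compmA runVK compm1.
Qed.

(** For any right module [X], the unit axiom factors the isomorphism
    [run X : X ⊗ 1 -> X] through [id ⊗ alg_unit A]. *)
Lemma alg_unit_neq0 : nontrivial (rmod_cat A) -> alg_unit A <> 0.
Proof.
move=> [X X_nz] u0; apply: X_nz; apply: is_zero_objectP.
apply: val_inj => /=; rewrite -runVK -rm_act1 u0.
by rewrite (linear_fun0 (bmor_linearr _ _)) compm0 comp0m.
Qed.

End FreeModules.

Lemma unit_split_mono (k : fieldType) (C : moncat k) (X : C)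
    (u : Hom (unit_ob C) X) :
  fusion C -> u <> 0 -> exists r : Hom X (unit_ob C), r ∘ u = idm (unit_ob C).
Proof.
move=> [[C_ab _ _] _ _ C_ss End1] u_nz.
have [S [i [p [S_simple _ ip]]]] := scalar_end_simple C_ss End1.
have ui_nz : u ∘ i <> 0.
  by move=> ui0; apply: u_nz; rewrite -[u]compm1 -ip compmA ui0 comp0m.
have [r rui] := simple_split_mono C_ab C_ss S_simple ui_nz.
exists (i ∘ r).
by rewrite -[u]compm1 -ip [u ∘ _]compmA -compmA [r ∘ _]compmA rui comp1m.
Qed.

Theorem proposition6p7 (k : closedFieldType) (C : moncat k) (M : modcat C)
    (C_fusion : fusion C)
    (M_module : is_module_category M) (M_semisimple : semisimple M)
    (M_indecomposable : indecomposable M) (M_nontrivial : nontrivial M)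
    (M0 : M) (A : internal_hom M0 M0)
    (E : functor (rmod_modcat (iend_algebra A)) M)
    (E_equivalence : module_equivalence E) :
  separable (functor_comp E (free_functor (iend_algebra A))).
Proof.
have [E_linear E_equiv _] := E_equivalence.
have CA_nontrivial := equivalence_nontrivial E_linear E_equiv M_nontrivial.
have [r ru] := unit_split_mono C_fusion (alg_unit_neq0 CA_nontrivial).
exact: separable_comp (equivalence_separable E_equiv) (free_functor_separable ru).
Qed.
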